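(* Let $\varphi:\mathbb{D}^2\to\overline{\mathbb{D}}$ be a rational analytic function (a quotient of polynomials in two variables), and let $\tau\in\mathbb{T}^2$. If $\tau$ is a $B^+$-point for $\varphi$, then $\tau$ is a $C$-point for $\varphi$.
   Context: $\mathbb{D}$ is the open unit disk in $\mathbb{C}$ and $\mathbb{T}$ the unit circle. Distances and norms on $\mathbb{C}^2$ are taken in the supremum norm, $\|z\|=\max(|z_1|,|z_2|)$; $B(\tau,\varepsilon)$ is the corresponding ball. A set $S\subset\mathbb{D}^2$ is nontangential at $\tau$ if there is $M>0$ with $\mathrm{dist}(z,\tau)\le M\,\mathrm{dist}(z,\partial\mathbb{D}^2)$ for all $z\in S$. $\varphi$ has a $B^+$-point at $\tau$ if there exist $\omega\in\mathbb{T}$ and $\alpha>0$ such that for every set $S$ nontangential at $\tau$ there is $\varepsilon>0$ with $|\varphi(z)-\omega|\le\alpha\|\tau-z\|$ for all $z\in S\cap B(\tau,\varepsilon)$ (so $\alpha$ does not depend on $S$). $\varphi$ has a $C$-point at $\tau$ if there exist $\omega\in\mathbb{T}$ and $\lambda\in\mathbb{C}^2$ such that for every set $S$ nontangential at $\tau$ and every $\beta>0$ there is $\varepsilon>0$ with $|\varphi(z)-\omega-\lambda\cdot(z-\tau)|\le\beta\|\tau-z\|$ for all $z\in S\cap B(\tau,\varepsilon)$, where $\lambda\cdot w=\lambda_1w_1+\lambda_2w_2$. (It is known to be equivalent that there exist $\omega\in\mathbb{T}$, $\lambda\in\mathbb{C}^2$ with $\varphi(z)\to\omega$ and $\nabla\varphi(z)\to\lambda$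 as $z\to\tau$ nontangentially.) *)

(* Defs.v *)
From HB Require Import structures.
From mathcomp Require Import all_boot all_order all_algebra complex.
From mathcomp Require Import all_classical all_reals all_analysis.

Set Implicit Arguments.
Unset Strict Implicit.
Unset Printing Implicit Defensive.

Import Order.TTheory GRing.Theory Num.Theory numFieldNormedType.Exports.

Local Open Scope classical_set_scope.
Local Open Scope complex_scope.
Local Open Scope ring_scope.

(* The usual norm and topology on R[i], as a normed module over itself.  The
   product R[i] * R[i] then carries the maximum norm and the product topology,
   and [differentiable] means complex differentiable. *)
HB.instance Definition _ (R : rcfType) := NormedModule.copy R[i] R[i]^o.

Section Bidisk.
Variable R : realType.
Implicit Types (z tau w lambda : R[i] * R[i]) (phi : R[i] * R[i] -> R[i]).

Definition bidisk : set (R[i] * R[i]) :=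
  [set z | `|z.1| < 1 /\ `|z.2| < 1].

Definition torus : set (R[i] * R[i]) :=
  [set z | `|z.1| = 1 /\ `|z.2| = 1].

Definition bidisk_boundary : set (R[i] * R[i]) :=
  closure bidisk `\` interior bidisk.

(* Norms of complex objects are elements of R[i] with zero imaginary part; the
   infimum has to be taken in R. *)
Definition dist z (A : set (R[i] * R[i])) : R :=
  inf [set complex.Re `|z - w| | w in A].

Definition nontangential tau (S : set (R[i] * R[i])) : Prop :=
  S `<=` bidisk /\
  exists M : R, 0 < M /\
    forall z, S z -> `|z - tau| <= (M * dist z bidisk_boundary)%:C.

Definition dot lambda w : R[i] := lambda.1 * w.1 + lambda.2 * w.2.

Definition Bplus_point phi tau : Prop :=
  exists (omega : R[i]) (alpha : R), `|omega| = 1 /\ 0 < alpha /\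
    forall S, nontangential tau S ->
      exists eps : R, 0 < eps /\
        forall z, (S `&` ball tau eps%:C) z ->
          `|phi z - omega| <= alpha%:C * `|tau - z|.

Definition C_point phi tau : Prop :=
  exists (omega : R[i]) lambda, `|omega| = 1 /\
    forall S, nontangential tau S ->
      forall beta : R, 0 < beta ->
        exists eps : R, 0 < eps /\
          forall z, (S `&` ball tau eps%:C) z ->
            `|phi z - omega - dot lambda (z - tau)| <= beta%:C * `|tau - z|.

(* Polynomials in two variables are elements of {poly {poly R[i]}}, with
   p.[z.1, z.2] = p.[z.1%:P].[z.2].  The denominator q is not assumed to be
   coprime to p or zero-free in the bidisk: phi is required to be analytic
   on the whole bidisk, and to be equal to p / q wherever q does not vanish. *)
Definition rational_analytic phi : Prop :=
  (forall z, bidisk z -> differentiable phi z) /\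
  exists p q : {poly {poly R[i]}}, q != 0 /\
    forall z, bidisk z -> q.[z.1, z.2] != 0 ->
      phi z = p.[z.1, z.2] / q.[z.1, z.2].

End Bidisk.

(* Main.v *)
Require Import Defs.
From mathcomp Require Import all_boot all_order all_algebra complex.
From mathcomp Require Import cyclic separable cyclotomic zify ring lra.
From mathcomp Require Import all_classical all_reals all_analysis.

(* Blow up at tau: put z = (tau_1 (1 - s x), tau_2 (1 - s)), so that x is the
   direction of approach and s its scale.  Then q = s^m H(s, x) with
   H(0, .) != 0, and the B+ bound, applied along the rays with fixed x off the
   slit (-oo, 0], gives p - omega q = s^(m+1) A(s, x) with
   |A(0, x)| <= alpha (1 + |x|) |H(0, x)|.  Since alpha does not depend on the
   ray, every zero of H(0, .) is cancelled and A(0, x) = (a x + b) H(0, x):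
   the first-order term s (a x + b) is linear in z - tau.  The remainder
   f = phi - omega - s (a x + b) satisfies f H = s^2 G with a polynomial G.  It
   is O(s^2) also at the directions where H(0, .) vanishes: for fixed s one
   cancels the zeros of H(s, .) in a disc of nontangential directions around
   x, and compares the values of the rest at x with those at nearby points. *)

Set Implicit Arguments.
Unset Strict Implicit.
Unset Printing Implicit Defensive.

Import Order.TTheory GRing.Theory Num.Theory.

Local Open Scope classical_set_scope.
Local Open Scope complex_scope.
Local Open Scope ring_scope.

(** * The modulus as a real number *)

Section Modulus.
Context {R : realType}.
Implicit Types (z w : R[i]) (t : R).

Definition modulus z : R := complex.Re `|z|.

Lemma modulusE z : `|z| = (modulus z)%:C.
Proof. by rewrite /modulus RRe_real ?normr_real. Qed.

Lemma lt_modulus z t : (`|z| < t%:C) = (modulus z < t).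
Proof. by rewrite modulusE ltcR. Qed.

Lemma modulusM z w : modulus (z * w) = modulus z * modulus w.
Proof. by apply: complexI; rewrite rmorphM /= -!modulusE normrM. Qed.

Lemma modulusX z n : modulus (z ^+ n) = modulus z ^+ n.
Proof. by apply: complexI; rewrite rmorphXn /= -!modulusE normrX. Qed.

Lemma modulusV z : modulus z^-1 = (modulus z)^-1.
Proof. by apply: complexI; rewrite fmorphV /= -!modulusE normfV. Qed.

Lemma modulusN z : modulus (- z) = modulus z.
Proof. by apply: complexI; rewrite -!modulusE normrN. Qed.

Lemma modulusB z w : modulus (z - w) = modulus (w - z).
Proof. by rewrite -modulusN opprB. Qed.

Lemma modulusD z w : modulus (z + w) <= modulus z + modulus w.
Proof. by rewrite -lecR rmorphD /= -!modulusE ler_normD. Qed.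

Lemma modulus_triangle z w x :
  modulus (z - w) <= modulus (z - x) + modulus (x - w).
Proof. by rewrite (le_trans _ (modulusD _ _)) // addrA subrK. Qed.

Lemma modulus_ge0 z : 0 <= modulus z.
Proof. by rewrite -lecR -modulusE; exact: normr_ge0. Qed.

Lemma modulus_eq0 z : (modulus z == 0) = (z == 0).
Proof. by rewrite -(inj_eq (@complexI R)) -modulusE normr_eq0. Qed.

Lemma modulus_gt0 z : (0 < modulus z) = (z != 0).
Proof. by rewrite lt_def modulus_ge0 modulus_eq0 andbT. Qed.

Lemma modulus0 : modulus 0 = 0.
Proof. by apply/eqP; rewrite modulus_eq0. Qed.

Lemma modulus1 : modulus 1 = 1.
Proof. by apply: complexI; rewrite -modulusE normr1 rmorph1. Qed.

Lemma modulus_real t : 0 <= t -> modulus t%:C = t.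
Proof. by move=> t0; apply: complexI; rewrite -modulusE ger0_norm // lecR. Qed.

Lemma modulus_sqr z :
  modulus z ^+ 2 = complex.Re z ^+ 2 + complex.Im z ^+ 2.
Proof. by apply: complexI; rewrite rmorphXn /= -modulusE add_Re2_Im2. Qed.

End Modulus.

(** * Polynomials: vanishing, bounds on discs, passage to a limit point *)

Lemma poly_eq0_injective_roots (D : idomainType) (f : nat -> D) (p : {poly D}) :
  injective f -> (forall n, p.[f n] = 0) -> p = 0.
Proof.
move=> fI pf; apply: (@roots_geq_poly_eq0 _ _ [seq f n | n <- iota 0 (size p)]).
- by apply/allP => _ /mapP[n _ ->]; apply/rootP.
- by rewrite map_inj_uniq ?iota_uniq.
- by rewrite size_map size_iota.
Qed.

Lemma poly0_factor (D : nzRingType) (p : {poly D}) :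
  exists G, p = p.[0]%:P + G * 'X.
Proof.
have /factor_theorem[G GE] : root (p - p.[0]%:P) 0 by rewrite rootE !hornerE subrr.
by exists G; rewrite -['X]subr0 -polyC0 -GE addrC subrK.
Qed.

Section Polynomials.
Context {R : realType}.
Local Notation C := R[i].
Implicit Types (A B K : {poly C}) (F : {poly {poly C}}).

Lemma poly_bounded A (r : R) :
  exists2 L : R, 0 <= L & forall z, modulus z <= r -> modulus A.[z] <= L.
Proof.
elim/poly_ind: A => [|A c [L L0 AL]].
  by exists 0 => // z _; rewrite horner0 modulus0.
exists (L * `|r| + modulus c); first by rewrite addr_ge0 ?mulr_ge0 ?modulus_ge0.
move=> z zr; rewrite !hornerE (le_trans (modulusD _ _)) // lerD2r modulusM.
by rewrite ler_pM ?modulus_ge0 ?AL // (le_trans zr) ?ler_norm.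
Qed.

Lemma poly2_bounded F (r1 r2 : R) :
  exists2 L : R, 0 <= L &
    forall s x, modulus s <= r1 -> modulus x <= r2 -> modulus F.[s, x] <= L.
Proof.
elim/poly_ind: F => [|F c [L L0 FL]].
  by exists 0 => // s x _ _; rewrite !horner0 modulus0.
have [M M0 cM] := poly_bounded c r2.
exists (L * `|r1| + M); first by rewrite addr_ge0 ?mulr_ge0.
move=> s x sr xr; rewrite !hornerE (le_trans (modulusD _ _)) // lerD ?cM //.
by rewrite modulusM ler_pM ?modulus_ge0 ?FL // (le_trans sr) ?ler_norm.
Qed.

Lemma poly_lipschitz0 A :
  exists2 L : R, 0 <= L &
    forall z, modulus z <= 1 -> modulus (A.[z] - A.[0]) <= L * modulus z.
Proof.
have /factor_theorem[B AB] : root (A - A.[0]%:P) 0.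
  by rewrite rootE !hornerE subrr.
have [L L0 BL] := poly_bounded B 1; exists L => // z z1.
have -> : A.[z] - A.[0] = B.[z] * z.
  transitivity (B * ('X - 0%:P)).[z]; first by rewrite -AB !hornerE.
  by rewrite hornerM hornerXsubC subr0.
by rewrite modulusM ler_wpM2r ?modulus_ge0 ?BL.
Qed.

Lemma exists_small_nonroot K (e : R) : K != 0 -> 0 < e ->
  exists2 t : R, 0 < t < e & K.[t%:C] != 0.
Proof.
(* These [size K] numbers are distinct, one more than [K] can have roots; the shift by 2 keeps them
   strictly below [e]. *)
move=> K0 e0; pose f n : R := e / n.+2%:R.
have f_gt0 n : 0 < f n by rewrite divr_gt0.
have [|/hasPn h] :=
  boolP (has (fun t => K.[t%:C] != 0) [seq f n | n <- iota 0 (size K)]).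
  move=> /hasP[_ /mapP[n _ ->] h]; exists (f n) => //; rewrite f_gt0 /=.
  by rewrite ltr_pdivrMr // ltr_pMr // ltr1n.
suff : (size [seq (f n)%:C | n <- iota 0 (size K)] < size K)%N.
  by rewrite size_map size_iota ltnn.
apply: max_poly_roots => //.
- apply/allP => _ /mapP[n nK ->]; rewrite rootE.
  by have := h (f n) (map_f _ nK); rewrite negbK.
- rewrite map_inj_uniq ?iota_uniq // => m n /complexI; rewrite /f.
  move=> /(mulfI (lt0r_neq0 e0))/invr_inj/eqP; rewrite eqr_nat => /eqP[].
  by [].
Qed.

(** Both sides are continuous at 0, and off the roots of [K] the ray has points arbitrarily near
    0. *)
Lemma horner_le_ray A B K (u : C) (c e : R) :
  K != 0 -> u != 0 -> 0 <= c -> 0 < e ->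
  (forall t : R, 0 < t < e -> K.[t%:C * u] != 0 ->
    modulus A.[t%:C * u] <= c * modulus B.[t%:C * u]) ->
  modulus A.[0] <= c * modulus B.[0].
Proof.
move=> K0 u0 c0 e0 AB.
have [L L0 AL] := poly_lipschitz0 A; have [M M0 BM] := poly_lipschitz0 B.
rewrite leNgt; apply/negP => gap.
have mu0 : 0 < modulus u by rewrite modulus_gt0.
pose g := modulus A.[0] - c * modulus B.[0].
have g0 : 0 < g by rewrite subr_gt0.
pose D := L + c * M + 1; have D0 : 0 < D by rewrite /D ltr_wpDl // addr_ge0 // mulr_ge0.
(* The bounds on [t] give [|t u| <= 1], where the Lipschitz estimates hold, and keep their total
   error below the gap [g]. *)
pose e' := Num.min e (Num.min (modulus u)^-1 (g / (D * modulus u))).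
have e'0 : 0 < e' by rewrite !lt_min e0 invr_gt0 mu0 divr_gt0 // mulr_gt0.
have Ku0 : K \Po (u *: 'X) != 0.
  apply: contra K0 => /eqP Ku; apply/eqP.
  rewrite -[K]comp_polyXr -[X in K \Po X](_ : (u *: 'X) \Po (u^-1 *: 'X) = 'X).
    by rewrite comp_polyA Ku comp_poly0.
  by rewrite comp_polyZ comp_polyX scalerA divff // scale1r.
have [t /andP[t0]] := exists_small_nonroot Ku0 e'0.
rewrite horner_comp !hornerE !lt_min => /and3P[te tu tg] Kt.
rewrite mulrC in Kt.
have mt : modulus (t%:C * u) = t * modulus u by rewrite modulusM modulus_real // ltW.
have t1 : modulus (t%:C * u) <= 1 by rewrite mt -ler_pdivlMr // mul1r ltW.
have hD : D * (t * modulus u) < g.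
  by move: tg; rewrite ltr_pdivlMr ?mulr_gt0 // mulrCA.
have := AL _ t1; have := BM _ t1; have := AB t.
rewrite t0 te => /(_ isT Kt); rewrite mt => h1 h2 h3.
have h4 := modulusD (A.[t%:C * u]) (- (A.[t%:C * u] - A.[0])).
have h5 := modulusD (B.[0]) (B.[t%:C * u] - B.[0]).
rewrite opprB addrC subrK modulusB in h4; rewrite addrC subrK in h5.
have tm0 : 0 < t * modulus u by rewrite mulr_gt0.
have h6 : c * modulus B.[t%:C * u] <= c * (modulus B.[0] + M * (t * modulus u)).
  by rewrite ler_wpM2l // (le_trans h5) // lerD2l.
rewrite /g /D in hD.
nra.
Qed.

(** * Cauchy estimates by roots of unity, and a bound for quotients *)

Lemma prim_root_exists n : (0 < n)%N -> exists z : C, n.-primitive_root z.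
Proof.
move=> n0; have [r Dp] := closed_field_poly_normal ('X^n - 1 : {poly C}).
rewrite (monicP _) ?monicXnsubC // scale1r in Dp.
have rn1 : all n.-unity_root r by apply/allP => z; rewrite -root_prod_XsubC -Dp.
have ur : uniq r.
  by rewrite -separable_prod_XsubC -Dp separable_Xn_sub_1 // pnatr_eq0 -lt0n.
have szr : (n <= size r)%N by rewrite -ltnS -(size_prod_XsubC r id) -Dp size_XnsubC.
by have /hasP[z _ zn] := has_prim_root n0 rn1 ur szr; exists z.
Qed.

Lemma sum_prim_root n j (z : C) : n.-primitive_root z -> ~~ (n %| j)%N ->
  \sum_(k < n) (z ^+ j) ^+ k = 0.
Proof.
move=> zn nj; have zj1 : z ^+ j - 1 != 0.
  by rewrite subr_eq0 -(prim_order_dvd zn).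
apply: (mulfI zj1); rewrite -subrX1 mulr0 -exprM mulnC exprM.
by rewrite (prim_expr_order zn) expr1n subrr.
Qed.

(** Discrete Cauchy formula: averaging [z ^- (k * j) * A.[r * z ^+ k]] over the [n]-th roots of
    unity, with [n = size A], isolates the coefficient of index [j] exactly, because all indices lie
    below [n]. *)
Lemma cauchy_estimate A (r M : R) j : 0 <= r ->
  (forall w, modulus w = r -> modulus A.[w] <= M) ->
  modulus A`_j * r ^+ j <= M.
Proof.
move=> r0 AM; have M0 : 0 <= M.
  by apply: le_trans (AM r%:C _); rewrite ?modulus_ge0 ?modulus_real.
have [jA|] := ltnP j (size A); last first.
  by move=> Aj; rewrite nth_default // modulus0 mul0r.
pose n := size A; have n0 : (0 < n)%N by apply: leq_trans jA.
have [z zn] := prim_root_exists n0.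
have mz : modulus z = 1.
  apply/eqP; rewrite -(@pexpr_eq1 _ _ n) ?modulus_ge0 // -modulusX.
  by rewrite (prim_expr_order zn) modulus1.
have z0 : z != 0 by rewrite -modulus_gt0 mz.
have key : \sum_(k < n) (z ^- (k * j)) * A.[r%:C * z ^+ k] = n%:R * (A`_j * r%:C ^+ j).
  under eq_bigr do rewrite horner_coef mulr_sumr.
  rewrite exchange_big /= (bigD1 (Ordinal jA)) //= [X in _ + X]big1 ?addr0;
    last first.
    move=> i ij.
    have iA : (i < n)%N := ltn_ord i; have jn : (j < n)%N := jA.
    (* [d] represents [i - j] modulo [n]; for [i != j] it lies strictly between 0 and [2 n] and
       differs from [n]. *)
    pose d := (i + (n - j))%N.
    have nd : ~~ (n %| d)%N.
      apply: contra ij => /dvdnP[c dc]; rewrite -val_eqE /=.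
      have : (d < 2 * n)%N by rewrite /d; lia.
      have : (0 < d)%N by rewrite /d; lia.
      rewrite dc; case: c dc => [|[|c]] dc; rewrite ?mul0n // ?mulSn; try lia.
    have := sum_prim_root zn nd => S0.
    rewrite -[RHS](mulr0 (A`_i * r%:C ^+ i)) -[X in _ = _ * X]S0 mulr_sumr.
    apply: eq_bigr => k _; rewrite exprMn -!exprM.
    suff -> : z ^+ (d * k) = z ^- (k * j) * z ^+ (k * i) by ring.
    apply: (mulfI (expf_neq0 (k * j) z0)); rewrite mulrA divff ?expf_neq0 // mul1r.
    rewrite -exprD (_ : (k * j + d * k = k * i + n * k)%N); last first.
      by rewrite /d; nia.
    by rewrite exprD [z ^+ (n * k)]exprM (prim_expr_order zn) expr1n mulr1.
  rewrite (eq_bigr (fun=> A`_j * r%:C ^+ j)) ?sumr_const ?card_ord ?mulr_natl //.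
  move=> k _; rewrite exprMn -exprM.
  by field; rewrite expf_neq0.
have nR : 0 < n%:R :> R by rewrite ltr0n.
rewrite -(ler_pM2l nR).
have <- : modulus (n%:R * (A`_j * r%:C ^+ j)) = n%:R * (modulus A`_j * r ^+ j).
  rewrite !modulusM modulusX modulus_real // -(rmorph_nat (real_complex R)).
  by rewrite modulus_real ?ltW.
rewrite -key; clear key.
have : forall m (f : 'I_m -> C), (forall k, modulus (f k) <= M) ->
    modulus (\sum_(k < m) f k) <= m%:R * M.
  elim=> [|m IH] f fM; first by rewrite big_ord0 modulus0 mul0r.
  rewrite big_ord_recr /= (le_trans (modulusD _ _)) // mulrSr mulrDl mul1r.
  by rewrite lerD // IH.
apply=> k; rewrite modulusM modulusV modulusX mz expr1n invr1 mul1r AM //.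
by rewrite modulusM modulusX mz expr1n mulr1 modulus_real.
Qed.

Lemma max_modulus_center A (x : C) (r M : R) : 0 <= r ->
  (forall w, modulus (w - x) = r -> modulus A.[w] <= M) -> modulus A.[x] <= M.
Proof.
move=> r0 AM; have := @cauchy_estimate (A \Po ('X + x%:P)) r M 0 r0.
rewrite expr0 mulr1 -horner_coef0 horner_comp !hornerE; apply=> w wr.
by rewrite horner_comp !hornerE AM // addrK.
Qed.

(** Otherwise the Cauchy estimate would bound the leading coefficient, which recentring at [x]
    preserves, by half of itself. *)
Lemma exists_large_on_circle A (x : C) (r : R) : 0 < r -> A != 0 ->
  exists2 y, modulus (y - x) = r &
    modulus (lead_coef A) * r ^+ (size A).-1 / 2 <= modulus A.[y].
Proof.
move=> r0 A0; apply: contrapT => nex.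
pose c := modulus (lead_coef A) * r ^+ (size A).-1.
have c0 : 0 < c by rewrite mulr_gt0 ?exprn_gt0 // modulus_gt0 lead_coef_eq0.
have := @cauchy_estimate (A \Po ('X + x%:P)) r (c / 2) (size A).-1 (ltW r0).
have -> : (A \Po ('X + x%:P))`_(size A).-1 = lead_coef A.
  have := @lead_coef_comp _ A ('X + x%:P).
  rewrite size_XaddC lead_coefXaddC => /(_ isT).
  rewrite expr1n mulr1 => <-; rewrite [in RHS]lead_coefE.
  by rewrite size_comp_poly size_XaddC muln1.
rewrite -/c => h; have : c <= c / 2; last by lra.
apply: h => w wr; rewrite horner_comp !hornerE leNgt; apply/negP => h.
by apply: nex; exists (w + x); rewrite ?addrK // ltW.
Qed.

(** For each root [a], [|y - a| <= |y - x| + |x - a| <= 2 |x - a|]. *)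
Lemma modulus_horner_ratio A (x y : C) n : (size A <= n)%N ->
  (forall a, root A a -> modulus (y - x) <= modulus (a - x)) ->
  modulus A.[y] <= 2 ^+ n * modulus A.[x].
Proof.
have [r Dp] := closed_field_poly_normal A; have [->|A0] := eqVneq A 0.
  by move=> _ _; rewrite !horner0 modulus0 mulr0.
have lA0 : lead_coef A != 0 by rewrite lead_coef_eq0.
move=> sA rA; have rn : (size r <= n)%N.
  by rewrite (leq_trans _ sA) // [in leqRHS]Dp size_scale // size_prod_XsubC.
have {}rA a : a \in r -> modulus (y - x) <= modulus (a - x).
  by move=> ar; apply: rA; rewrite Dp rootZ // root_prod_XsubC.
rewrite Dp; move: (lead_coef A) => l; rewrite !hornerZ !modulusM mulrCA.
rewrite ler_wpM2l ?modulus_ge0 //.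
apply: (@le_trans _ _ (2 ^+ size r * modulus (\prod_(z <- r) ('X - z%:P)).[x]));
  last first.
  by rewrite ler_wpM2r ?modulus_ge0 // ler_weXn2l // ler1n.
elim: r rA {Dp rn} => [|a r IH] rA; first by rewrite big_nil /= expr0 mul1r !hornerE.
rewrite !big_cons !hornerM !modulusM !hornerXsubC exprS mulrACA.
rewrite ler_pM ?modulus_ge0 //.
  have := modulus_triangle y a x; have := rA a (mem_head _ _).
  by rewrite [modulus (x - a)]modulusB; lra.
by apply: IH => b br; apply: rA; rewrite inE br orbT.
Qed.

(* What is used of the continuity of [f] on the disc. *)
Definition polynomial_removable (f : C -> C) (x : C) (r : R) :=
  forall A B K, K != 0 ->
    (forall z, modulus (z - x) < r -> K.[z] != 0 -> f z * B.[z] = A.[z]) ->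
    forall z, modulus (z - x) < r -> f z * B.[z] = A.[z].

(** Freezing [f z] turns the claim into one on the polynomial [f z * B - A]; at nearby points [w]
    off the roots of [K] it equals [(f z - f w) * B], which continuity makes small. *)
Lemma removable_of_continuous (f : C -> C) (x : C) (r : R) :
  (forall z : C, modulus (z - x) < r -> forall e : R, 0 < e ->
    exists2 d : R, 0 < d &
      forall t : R, 0 < t < d -> modulus (f (z + t%:C) - f z) <= e) ->
  polynomial_removable f x r.
Proof.
move=> cf A B K K0 fBA z zx.
pose P := f z *: (B \Po ('X + z%:P)) - (A \Po ('X + z%:P)).
have PE t : P.[t] = f z * B.[t + z] - A.[t + z].
  by rewrite /P hornerD hornerN hornerZ !horner_comp !hornerE.
apply/eqP; rewrite -subr_eq0 -[z in B.[z]]add0r -[z in A.[z]]add0r -PE -modulus_eq0.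
rewrite eq_le modulus_ge0 andbT; apply/ler_addgt0Pr => e e0; rewrite add0r.
pose e1 := e / (modulus B.[z] + 1).
have B1 : 0 < modulus B.[z] + 1 by rewrite ltr_wpDl ?modulus_ge0.
have e10 : 0 < e1 by rewrite divr_gt0.
have [d d0 fd] := cf z zx e1 e10.
apply: (@le_trans _ _ (e1 * modulus (B \Po ('X + z%:P)).[0])); last first.
  rewrite horner_comp !hornerE ?add0r /e1 mulrAC ler_pdivrMr // ler_wpM2l ?(ltW e0) //.
  by rewrite lerDl.
have m0 : 0 < Num.min d (r - modulus (z - x)) by rewrite lt_min d0 subr_gt0.
apply: (@horner_le_ray P _ (K \Po ('X + z%:P)) 1 e1 _ _ (oner_neq0 _) (ltW e10) m0).
  by rewrite comp_poly_eq0 // size_XaddC.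
move=> t /andP[t0]; rewrite lt_min => /andP[td tr].
rewrite mulr1 PE !horner_comp !hornerE => Kt.
rewrite -(fBA (t%:C + z)) //; last first.
  by rewrite -addrA (le_lt_trans (modulusD _ _)) // modulus_real ?ltW // -ltrBrDr.
rewrite -mulrBl modulusM ler_wpM2r ?modulus_ge0 // modulusB [t%:C + z]addrC.
by apply: fd; rewrite t0.
Qed.

(* The roots of [B] inside the disc are cancelled one by one; for the remaining
   denominator, [modulus_horner_ratio] compares its values at [x] and [y]. *)
Lemma quotient_bound (f : C -> C) (x y : C) (r M d : R) A B n :
  0 < r -> polynomial_removable f x r ->
  (forall z, modulus (z - x) < r -> f z * B.[z] = A.[z]) ->
  (forall w, modulus (w - x) = 2 * r -> modulus A.[w] <= M) ->
  modulus (y - x) <= r -> 0 < d -> d <= modulus B.[y] ->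
  (size B <= n)%N ->
  modulus (f x) * d <= 2 ^+ n * M.
Proof.
move=> r0 remf; elim: n => [|n IH] in A B M d *.
  move=> _ _ _ d0; rewrite leqn0 size_poly_eq0 => dB /eqP B0.
  by move: dB; rewrite B0 horner0 modulus0 leNgt d0.
move=> fBA AM yx d0 dB sB.
(* Dividing [A] and [B] by ['X - a] costs a factor 2: on the circle of radius [2 r] one has
   [|w - a| >= r], while [|y - a| <= 2 r]. *)
have [[a [aB ax]]|nex] := pselect (exists a, root B a /\ modulus (a - x) < r).
  have /factor_theorem[B1 BB] := aB.
  have /factor_theorem[A1 AA] : root A a by rewrite rootE -fBA // (rootP aB) mulr0.
  have M0 : 0 <= M.
    apply: le_trans (modulus_ge0 _) (AM (x + (2 * r)%:C) _).
    by rewrite addrC addKr modulus_real // mulr_ge0 // ltW.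
  suff h : modulus (f x) * (d / (2 * r)) <= 2 ^+ n * (M / r).
    have -> : modulus (f x) * d = modulus (f x) * (d / (2 * r)) * (2 * r).
      by field; rewrite gt_eqF.
    have -> : 2 ^+ n.+1 * M = 2 ^+ n * (M / r) * (2 * r).
      by rewrite exprS; field; rewrite gt_eqF.
    by rewrite ler_pM2r ?mulr_gt0.
  apply: (IH A1 B1).
  (* After the division the identity is known only off [a]; removability restores it at [a]. *)
  - apply: (remf _ _ ('X - a%:P)); rewrite ?polyXsubC_eq0 // => z zx.
    rewrite hornerXsubC => za; apply: (mulIf za).
    by rewrite -mulrA -hornerXsubC -!hornerM -BB -AA fBA.
  - move=> w wx; have wa : r <= modulus (w - a).
      by have := modulus_triangle w x a; rewrite wx; lra.
    rewrite ler_pdivlMr // (le_trans _ (AM _ wx)) // AA hornerM hornerXsubC modulusM.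
    by rewrite ler_wpM2l ?modulus_ge0.
  - by [].
  - by rewrite divr_gt0 ?mulr_gt0.
  - rewrite ler_pdivrMr ?mulr_gt0 // (le_trans dB) // BB hornerM hornerXsubC modulusM.
    rewrite ler_wpM2l ?modulus_ge0 //.
    by have := modulus_triangle y a x; rewrite [modulus (x - a)]modulusB; lra.
  - have [B10|B10] := eqVneq B1 0; first by rewrite B10 size_poly0.
    by move: sB; rewrite BB size_Mmonic ?monicXsubC // size_XsubC addn2.
(* Without roots in the disc, [|B.[y]|] is at most a power of 2 times [|B.[x]|], and [f x * B.[x] =
   A.[x]] is bounded by the maximum principle. *)
have xx : modulus (x - x) < r by rewrite subrr modulus0.
apply: (@le_trans _ _ (modulus (f x) * (2 ^+ n.+1 * modulus B.[x]))).
  rewrite ler_wpM2l ?modulus_ge0 // (le_trans dB) // modulus_horner_ratio //.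
  move=> a aB; rewrite (le_trans yx) // leNgt; apply/negP => ax.
  by apply: nex; exists a.
rewrite mulrCA -modulusM fBA // ler_wpM2l ?exprn_ge0 //.
by apply: max_modulus_center AM; rewrite mulr_ge0 // ltW.
Qed.

(** * Growth conditions that force an affine factor *)

Lemma poly_eq0_of_decay A (c : R) :
  (forall t : R, 1 <= t -> modulus A.[t%:C] <= c / t) -> A = 0.
Proof.
elim/poly_ind: A c => // A a IH c h.
(* If [A * 'X + a] is O(1/t), then [A] is O(1/t) as well. *)
have A0 : A = 0.
  apply: (IH (c + modulus a)) => t t1; have t0 : 0 < t by lra.
  rewrite ler_pdivlMr //.
  have -> : modulus A.[t%:C] * t = modulus ((A * 'X + a%:P).[t%:C] - a).
    by rewrite !hornerE addrK modulusM modulus_real // ltW.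
  rewrite (le_trans (modulusD _ _)) // modulusN lerD2r (le_trans (h _ t1)) //.
  rewrite ler_pdivrMr // ler_peMr //.
  by have := h 1 (lexx _); rewrite divr1; apply: le_trans; exact: modulus_ge0.
move: h; rewrite A0 mul0r add0r => h; have [-> //|a0] := eqVneq a 0.
have ma0 : 0 < modulus a by rewrite modulus_gt0.
have cma : 0 <= `|c| / modulus a by rewrite divr_ge0 // ltW.
exfalso; have := h (1 + `|c| / modulus a); rewrite hornerC lerDl cma => /(_ isT).
rewrite ler_pdivlMr; last by rewrite ltr_wpDr.
by rewrite mulrDr mulr1 mulrCA divff ?gt_eqF // mulr1; have := ler_norm c; lra.
Qed.

(** Removing the two lowest coefficients, with a division by the variable each time, leaves a
    polynomial that is O(1/t), hence zero. *)
Lemma affine_of_linear_growth A (c : R) :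
  (forall t : R, 1 <= t -> modulus A.[t%:C] <= c * (1 + t)) ->
  exists a b, A = a *: 'X + b%:P.
Proof.
elim/poly_ind: A => [|A b _] h; first by exists 0, 0; rewrite scale0r polyC0 addr0.
have c0 : 0 <= c.
  by have := h 1 (lexx _); have := modulus_ge0 (A * 'X + b%:P).[1%:C]; lra.
have {}h (t : R) : 1 <= t -> modulus A.[t%:C] <= 2 * c + modulus b.
  move=> t1; have t0 : 0 < t by lra.
  rewrite -(ler_pM2r t0).
  have -> : modulus A.[t%:C] * t = modulus ((A * 'X + b%:P).[t%:C] - b).
    by rewrite !hornerE addrK modulusM modulus_real // ltW.
  rewrite (le_trans (modulusD _ _)) // modulusN.
  by have := h _ t1; have := modulus_ge0 b; nra.
move: h; elim/poly_ind: A => [|A a _] h.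
  by exists 0, b; rewrite scale0r mul0r.
suff -> : A = 0 by exists a, b; rewrite mul0r add0r mul_polyC.
apply: (@poly_eq0_of_decay _ (2 * c + modulus b + modulus a)) => t t1.
have t0 : 0 < t by lra.
rewrite ler_pdivlMr //.
have -> : modulus A.[t%:C] * t = modulus ((A * 'X + a%:P).[t%:C] - a).
  by rewrite !hornerE addrK modulusM modulus_real // ltW.
by rewrite (le_trans (modulusD _ _)) // modulusN lerD2r h.
Qed.

Lemma sqrt_right_half (x : C) : exists2 y, y ^+ 2 = x & 0 <= complex.Re y.
Proof.
have [h|/ltW h] := leP 0 (complex.Re (sqrtC x)).
  by exists (sqrtC x); rewrite ?sqrtCK.
by exists (- sqrtC x); rewrite ?sqrrN ?sqrtCK // raddfN oppr_ge0.
Qed.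

(* The points [y ^+ 2] with [0 < Re y] are those of the plane slit along the
   nonpositive reals. *)
Lemma affine_multiple A B K (c : R) : B != 0 -> K != 0 -> 0 <= c ->
  (forall y, 0 < complex.Re y -> K.[y ^+ 2] != 0 ->
    modulus A.[y ^+ 2] <= c * (1 + modulus (y ^+ 2)) * modulus B.[y ^+ 2]) ->
  exists a b, A = (a *: 'X + b%:P) * B.
Proof.
have [n] := ubnP (size B); elim: n => // n IH in A B K c *; rewrite ltnS => sB.
move=> B0 K0 c0 AB.
have [sB1|sB1] := eqVneq (size B) 1%N.
  have /size_poly1P[b b0 Bb] : size B == 1%N by rewrite sB1.
  suff [a' [b' ->]] : exists a' b', A = a' *: 'X + b'%:P.
    exists (a' / b), (b' / b).
    rewrite Bb mulrDl -polyCM divfK // mulrC mul_polyC scalerA.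
    by rewrite mulrC divfK.
  apply: (@affine_of_linear_growth _ (c * modulus b)) => t t1.
  have t0 : 0 < t by lra.
  (* The point [t] may be a root of [K]; it is approached through the reals [t + e], which are
     squares of positive numbers. *)
  have := @horner_le_ray (A \Po ('X + t%:C%:P)) (((1 + t)%:C%:P + 'X) * b%:P)
    (K \Po ('X + t%:C%:P)) 1 c 1 _ (oner_neq0 _) c0 ltr01.
  rewrite !horner_comp !hornerE modulusM modulus_real ?addr_ge0 ?(ltW t0) //.
  rewrite [_ * modulus b]mulrC mulrA; apply.
    by rewrite comp_poly_eq0 // size_XaddC.
  move=> e /andP[e0 e1]; rewrite !horner_comp !hornerE => Kt.
  have te0 : 0 < e + t by lra.
  have te : e%:C + t%:C = (Num.sqrt (e + t))%:C ^+ 2.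
    by rewrite -rmorphXn /= sqr_sqrtr ?ltW // rmorphD.
  rewrite te in Kt *; have := AB _ _ Kt; rewrite /= sqrtr_gt0 te0 => /(_ isT).
  rewrite -te Bb hornerC -rmorphD /= modulus_real ?(ltW te0) //.
  rewrite modulusM -mulrA; suff -> : (1 + t)%:C + e%:C = (1 + (e + t))%:C.
    by rewrite modulus_real // addr_ge0 // ltW.
  by rewrite !rmorphD /=; ring.
have [r rB] : exists r, root B r by apply/closed_rootP.
(* The root [r] may lie on the slit. If [y ^+ 2 = r] and [Re y >= 0], the path [(t + y) ^+ 2] with
   [t > 0] avoids the slit and ends at [r], so the bound forces [A] to vanish there. *)
have rA : root A r.
  have [y yr y0] := sqrt_right_half r.
  pose T := ('X - (- y)%:P) ^+ 2 : {poly C}.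
  have sT : size T = 3 by rewrite size_exp_XsubC.
  have TE z : T.[z] = (z + y) ^+ 2 by rewrite horner_exp hornerXsubC opprK.
  have := @horner_le_ray (A \Po T) (B \Po T) (K \Po T) 1
    (c * (1 + (1 + modulus y) ^+ 2)) 1 _ (oner_neq0 _) _ ltr01.
  rewrite !horner_comp TE add0r yr (rootP rB) modulus0 mulr0 => h.
  rewrite rootE -modulus_eq0 eq_le modulus_ge0 andbT; apply: h.
  - by rewrite comp_poly_eq0 // sT.
  - by rewrite mulr_ge0 // addr_ge0 // exprn_ge0 // addr_ge0 // modulus_ge0.
  - move=> t /andP[t0 t1]; rewrite !horner_comp TE mulr1 => Kt.
    have Ry : 0 < complex.Re (t%:C + y) by rewrite raddfD /= ltr_wpDr.
    apply: le_trans (AB _ Ry Kt) _; rewrite ler_wpM2r ?modulus_ge0 //.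
    rewrite ler_wpM2l // lerD2l modulusX.
    rewrite lerXn2r ?nnegrE ?modulus_ge0 ?addr_ge0 ?modulus_ge0 //.
    by rewrite (le_trans (modulusD _ _)) // lerD2r modulus_real // ltW.
have /factor_theorem[B1 BB] := rB; have /factor_theorem[A1 AA] := rA.
have B10 : B1 != 0 by apply: contra_neq B0 => B10; rewrite BB B10 mul0r.
(* The cancelled root joins the exceptional set: the bound can be divided by [|z - r|] only off
   [r]. *)
have [|||a [b A1E]] := IH A1 B1 (K * ('X - r%:P)) c _ B10 _ c0.
- by apply: leq_trans sB; rewrite BB size_Mmonic ?monicXsubC // size_XsubC addn2.
- by rewrite mulf_neq0 ?polyXsubC_eq0.
- move=> y y0; rewrite hornerM hornerXsubC mulf_eq0 negb_or => /andP[Ky ry].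
  have := AB _ y0 Ky; rewrite AA BB !hornerM hornerXsubC !modulusM mulrA.
  by rewrite ler_pM2r // modulus_gt0.
- by exists a, b; rewrite AA BB A1E mulrA.
Qed.

(** * The blow-up of polynomials at a point of the torus *)

Lemma blow_up1 (t2 : C) A :
  exists F, forall s x, F.[s, x] = A.[t2 * (1 - s)].
Proof.
elim/poly_ind: A => [|A a [F FE]]; first by exists 0 => s x; rewrite !horner0.
exists (F * (t2%:P%:P - t2%:P%:P * 'X) + a%:P%:P) => s x.
rewrite !(hornerD, hornerM, hornerN, hornerC, hornerX) FE.
by rewrite (_ : t2 - t2 * s = t2 * (1 - s)) // mulrBr mulr1.
Qed.

(** The outer variable of [F] is the scale [s] and its coefficients are polynomials in the direction
    [x]; thus [F.[0]] is a polynomial in [x]. *)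
Lemma blow_up (t1 t2 : C) (p : {poly {poly C}}) :
  exists F, forall s x, F.[s, x] = p.[t1 * (1 - s * x), t2 * (1 - s)].
Proof.
elim/poly_ind: p => [|p c [F FE]]; first by exists 0 => s x; rewrite !horner0.
have [G GE] := blow_up1 t2 c.
exists (F * (t1%:P%:P - t1%:P%:P * ('X * 'X%:P)) + G) => s x.
rewrite !(hornerD, hornerM, hornerN, hornerC, hornerX) FE GE.
by rewrite (_ : t1 - t1 * (s * x) = t1 * (1 - s * x)) // mulrBr mulr1.
Qed.

(** The blow-up reaches every point whose second coordinate differs from [t2], so [p] vanishes on an
    infinite grid. *)
Lemma blow_up_eq0 (t1 t2 : C) (p F : {poly {poly C}}) : t1 != 0 -> t2 != 0 ->
  (forall s x, F.[s, x] = p.[t1 * (1 - s * x), t2 * (1 - s)]) ->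
  F = 0 -> p = 0.
Proof.
move=> t10 t20 FE F0.
have nI : injective (fun n => n%:R : C) by move=> m n /eqP; rewrite eqr_nat => /eqP.
apply: (@poly_eq0_injective_roots _ (fun n => (n%:R : C)%:P)).
  by move=> m n /polyC_inj/nI.
move=> m; apply: (@poly_eq0_injective_roots _ (fun n => t2 * (1 - n.+1%:R))).
  by move=> n n' /(mulfI t20)/addrI/oppr_inj/nI[].
(* The scale [n + 1] is nonzero, and this direction solves [t1 * (1 - s * x) = m]. *)
move=> n; have := FE n.+1%:R ((1 - m%:R / t1) / n.+1%:R).
have inv_s (N M : C) : N != 0 -> t1 * (1 - N * ((1 - M / t1) / N)) = M.
  by move=> N0; field; rewrite t10 N0.
by rewrite inv_s ?pnatr_eq0 // F0 !horner0 => <-.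
Qed.

End Polynomials.

(** * The maximum norm, the boundary of the bidisk and the distance to it *)

Section Bidisk.
Context {R : realType}.
Local Notation C := R[i].
Implicit Types (z w tau : C * C).

Lemma pair_normE z : `|z| = (Num.max (modulus z.1) (modulus z.2))%:C.
Proof. by rewrite prod_normE !modulusE /Order.max ltcR; case: ifP. Qed.

Lemma bidiskE z : bidisk z <-> modulus z.1 < 1 /\ modulus z.2 < 1.
Proof. by rewrite /bidisk /= -[1]/((1 : R)%:C) !lt_modulus. Qed.

Lemma ball_pairE z w (e : R) :
  ball z e%:C w <-> modulus (z.1 - w.1) < e /\ modulus (z.2 - w.2) < e.
Proof.
rewrite ball_prod_normE /ball_ /= pair_normE ltcR gt_max /=.
by split=> [/andP[]|[-> ->]].
Qed.

Lemma nbhs_pairP z (B : set (C * C)) :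
  nbhs z B <-> exists2 e : R, 0 < e & ball z e%:C `<=` B.
Proof.
split=> [/nbhs_ballP[e /= e0 eB]|[e e0 eB]]; last first.
  by apply/nbhs_ballP; exists e%:C; rewrite //= ltcR.
have /complex_realP[k ek] : e \is Num.real by rewrite gtr0_real.
by exists k; [rewrite -ltcR -ek | rewrite -ek].
Qed.

Lemma bidisk_boundaryE w : bidisk_boundary w <->
  Num.max (modulus w.1) (modulus w.2) = 1.
Proof.
rewrite /bidisk_boundary /=; split=> [[cw iw]|w1].
  have nw : ~ bidisk w.
    move=> bw; apply: iw; have /bidiskE[w1 w2] := bw.
    apply/nbhs_pairP; exists (Num.min (1 - modulus w.1) (1 - modulus w.2)).
      by rewrite lt_min !subr_gt0 w1.
    move=> v /ball_pairE; rewrite !lt_min => -[/andP[v1 _] /andP[_ v2]]; apply/bidiskE.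
    have := modulus_triangle v.1 0 w.1; have := modulus_triangle v.2 0 w.2.
    by rewrite !subr0 modulusB [in X in _ -> X -> _]modulusB; split; lra.
  apply/eqP; rewrite eq_le; apply/andP; split; rewrite leNgt; apply/negP => wm.
    pose e := Num.max (modulus w.1) (modulus w.2) - 1.
    have [|v [/bidiskE[v1 v2]]] := cw (ball w e%:C).
      by apply/nbhs_pairP; exists e; rewrite ?subr_gt0.
    move/ball_pairE.
    have := modulus_triangle w.1 0 v.1; have := modulus_triangle w.2 0 v.2.
    rewrite !subr0 => h2 h1 [k1 k2]; move: wm k1 k2.
    by rewrite /e /Order.max; case: ifP => _; lra.
  by move: wm; rewrite gt_max => /andP[m1 m2]; apply/nw/bidiskE.
have [m1 m2] : modulus w.1 <= 1 /\ modulus w.2 <= 1.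
  by apply/andP; rewrite -ge_max w1.
split; last first.
  move=> /interior_subset/bidiskE[n1 n2].
  have : Num.max (modulus w.1) (modulus w.2) < 1 by rewrite gt_max n1.
  by rewrite w1 ltxx.
move=> B /nbhs_pairP[e e0 eB].
(* Scaling [w] by [1 - d] enters the bidisk and moves each coordinate by at most [d < e]. *)
pose d := Num.min (1 / 2) (e / 2).
have d0 : 0 < d by rewrite lt_min !divr_gt0.
have [d1 d2] : d < 1 /\ d < e by rewrite !gt_min; split; apply/orP; [left|right]; lra.
have d3 : 0 <= 1 - d by lra.
exists ((1 - d)%:C * w.1, (1 - d)%:C * w.2); split.
  by apply/bidiskE; rewrite /= !modulusM modulus_real //; split; nra.
have wd (c : C) : c - (1 - d)%:C * c = d%:C * c by rewrite rmorphB /= rmorph1; ring.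
by apply/eB/ball_pairE; rewrite /= !wd !modulusM modulus_real ?(ltW d0) //; split; nra.
Qed.

Lemma nearest_unit (c : C) : modulus c <= 1 ->
  exists2 w, modulus w = 1 & modulus (c - w) = 1 - modulus c.
Proof.
move=> c1; have [w w1 cw] : exists2 w, modulus w = 1 & c = (modulus c)%:C * w.
  have [->|c0] := eqVneq c 0; first by exists 1; rewrite ?modulus1 // modulus0 mul0r.
  have mc0 : (modulus c)%:C != 0 by rewrite -modulusE normr_eq0.
  exists (c / (modulus c)%:C); last by rewrite mulrCA divff ?mulr1.
  rewrite modulusM modulusV modulus_real ?modulus_ge0 // divff //.
  by rewrite modulus_eq0.
exists w => //; rewrite {1}cw.
have -> : (modulus c)%:C * w - w = - ((1 - modulus c)%:C * w).
  by rewrite rmorphB /= rmorph1; ring.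
by rewrite modulusN modulusM w1 mulr1 modulus_real // subr_ge0.
Qed.

(** The triangle inequality gives the lower bound; it is attained by moving one coordinate radially
    to the unit circle and keeping the other. *)
Lemma dist_bidisk z : bidisk z ->
  dist z (@bidisk_boundary R) = Num.min (1 - modulus z.1) (1 - modulus z.2).
Proof.
move=> /bidiskE[z1 z2].
have lb : lbound [set complex.Re `|z - w| | w in @bidisk_boundary R]
    (Num.min (1 - modulus z.1) (1 - modulus z.2)).
  move=> _ [w /bidisk_boundaryE w1 <-]; rewrite pair_normE /=.
  have := modulus_triangle w.1 0 z.1; have := modulus_triangle w.2 0 z.2.
  rewrite !subr0 [modulus (w.1 - _)]modulusB [modulus (w.2 - _)]modulusB.
  move: w1; rewrite /Order.max /Order.min; do 3!case: ifP; lra.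
have mem w : bidisk_boundary w ->
    [set complex.Re `|z - w| | w in @bidisk_boundary R] (complex.Re `|z - w|).
  by move=> bw; exists w.
have [w1 w11 zw1] := nearest_unit (ltW z1); have [w2 w21 zw2] := nearest_unit (ltW z2).
have b1 : bidisk_boundary (w1, z.2).
  by apply/bidisk_boundaryE; rewrite /= w11; apply/max_idPl/ltW.
have b2 : bidisk_boundary (z.1, w2).
  by apply/bidisk_boundaryE; rewrite /= w21; apply/max_idPr/ltW.
apply/eqP; rewrite eq_le; apply/andP; split; last first.
  by apply: lb_le_inf => //; exists (complex.Re `|z - (w1, z.2)|); exact: mem.
have hlb : has_lbound [set complex.Re `|z - w| | w in @bidisk_boundary R].
  by exists (Num.min (1 - modulus z.1) (1 - modulus z.2)).
rewrite le_min; apply/andP; split.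
  apply: le_trans (ge_inf hlb (mem _ b1)) _; rewrite pair_normE /= zw1 subrr modulus0.
  by rewrite ge_max lexx subr_ge0 ltW.
apply: le_trans (ge_inf hlb (mem _ b2)) _; rewrite pair_normE /= zw2 subrr modulus0.
by rewrite ge_max lexx subr_ge0 ltW.
Qed.

(** * The B+ bound along rays *)

Definition Bplus_bound (phi : C * C -> C) tau (omega : C) (alpha : R) : Prop :=
  forall S, nontangential tau S -> exists eps : R, 0 < eps /\
    forall z, (S `&` ball tau eps%:C) z ->
      `|phi z - omega| <= alpha%:C * `|tau - z|.

Definition blow_pt tau (s x : C) : C * C :=
  (tau.1 * (1 - s * x), tau.2 * (1 - s)).

(** Here [|1 - t c|^2 = 1 - 2 t Re c + t^2 |c|^2 < 1 - t Re c <= (1 - t Re c / 2)^2]. *)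
Lemma modulus_1B (c : C) (t : R) : 0 < t -> t * modulus c ^+ 2 < complex.Re c ->
  modulus (1 - t%:C * c) <= 1 - t * complex.Re c / 2.
Proof.
move=> t0 tc; have sq := modulus_sqr (1 - t%:C * c).
have e1 : complex.Re (1 - t%:C * c) = 1 - t * complex.Re c.
  by case: c {tc sq} => a b /=; rewrite mul0r subr0.
have e2 : complex.Im (1 - t%:C * c) = - (t * complex.Im c).
  by case: c {tc sq e1} => a b /=; rewrite mul0r addr0 sub0r.
have m0 := modulus_ge0 (1 - t%:C * c).
rewrite modulus_sqr in tc; rewrite e1 e2 in sq.
move: (modulus _) m0 sq => m m0 sq.
move: (complex.Re c) (complex.Im c) tc sq => a b tc sq.
have h : m ^+ 2 <= 1 - t * a by rewrite sq; nra.
have ta : t * a <= 1 by have := sqr_ge0 m; lra.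
rewrite -(@ler_pXn2r _ 2) ?nnegrE //; last by lra.
by apply: le_trans h _; nra.
Qed.

(** For [s = t conj(y)], both [s] and [s * y ^+ 2 = t |y|^2 y] have positive real part, so both
    coordinates enter the disc at a rate linear in [t]: the ray is nontangential. Its aperture
    depends on [y], but [alpha] does not. *)
Lemma Bplus_ray (phi : C * C -> C) tau (omega : C) (alpha : R) (y : C) :
  torus tau ->
  Bplus_bound phi tau omega alpha ->
  0 <= alpha -> 0 < complex.Re y ->
  exists2 e : R, 0 < e & forall t : R, 0 < t < e ->
    let s := t%:C * y^*%C in
    bidisk (blow_pt tau s (y ^+ 2)) /\
    modulus (phi (blow_pt tau s (y ^+ 2)) - omega)
      <= alpha * (1 + modulus (y ^+ 2)) * modulus s.
Proof.
move=> [tau1 tau2] B a0 y0.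
have mt1 : modulus tau.1 = 1 by apply: complexI; rewrite -modulusE tau1.
have mt2 : modulus tau.2 = 1 by apply: complexI; rewrite -modulusE tau2.
pose u : C := y^*%C; pose v := u * y ^+ 2.
have u0 : 0 < complex.Re u by rewrite /u; case: (y) y0.
have v0 : 0 < complex.Re v.
  have -> : v = (modulus y ^+ 2)%:C * y.
    by rewrite /v expr2 mulrA [u * y]mulrC -sqr_normc modulusE rmorphXn.
  have : 0 < modulus y.
    by rewrite modulus_gt0; apply: contraTneq y0 => ->; rewrite ltxx.
  case: (y) y0 => a b /= a_gt0 m_gt0; rewrite mul0r subr0 mulr_gt0 ?exprn_gt0 //.
have nz (c : C) : 0 < complex.Re c -> 0 < modulus c.
  by move=> c0; rewrite modulus_gt0; apply: contraTneq c0 => ->; rewrite ltxx.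
have mu := nz _ u0; have mv := nz _ v0.
(* Below [t0], [modulus_1B] applies to both [u] and [v]. *)
pose t0 := Num.min (complex.Re u / modulus u ^+ 2) (complex.Re v / modulus v ^+ 2).
have t00 : 0 < t0 by rewrite lt_min !divr_gt0 ?exprn_gt0.
pose k := Num.min (complex.Re u) (complex.Re v) / 2.
have k0 : 0 < k by rewrite divr_gt0 // lt_min u0.
pose pt t := blow_pt tau (t%:C * u) (y ^+ 2).
have ptb t : 0 < t -> t < t0 ->
    modulus (pt t).1 <= 1 - t * k /\ modulus (pt t).2 <= 1 - t * k.
  move=> t_gt0; rewrite lt_min !ltr_pdivlMr ?exprn_gt0 // => /andP[tu tv].
  rewrite /pt /blow_pt /= !modulusM mt1 mt2 !mul1r -mulrA -/v.
  have := modulus_1B t_gt0 tu; have := modulus_1B t_gt0 tv.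
  have : k <= complex.Re u / 2 by rewrite ler_wpM2r // ge_min lexx.
  have : k <= complex.Re v / 2 by rewrite ler_wpM2r // ge_min lexx orbT.
  by split; nra.
have ptd t : 0 < t -> `|tau - pt t| = (t * Num.max (modulus v) (modulus u))%:C.
  move=> t_gt0; rewrite pair_normE /pt /blow_pt /=.
  have e (c d : C) : c - c * (1 - d) = c * d by ring.
  rewrite !e !modulusM mt1 mt2 !mul1r modulus_real ?(ltW t_gt0) //.
  by rewrite -mulrA -modulusM -/v maxr_pMr // ltW.
have [|e [e0 Be]] := B [set pt t | t in [set t : R | 0 < t < t0]].
- split.
    move=> _ [t /andP[t_gt0 tt0] <-]; apply/bidiskE; have [] := ptb _ t_gt0 tt0.
    by have : 0 < t * k := mulr_gt0 t_gt0 k0; split; lra.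
  (* On the ray, the distance to [tau] is [t * max(|v|, |u|)] and the distance to the boundary is at
     least [t * k]. *)
  exists (Num.max (modulus v) (modulus u) / k); split.
    by rewrite divr_gt0 // lt_max mv.
  move=> _ [t /andP[t_gt0 tt0] <-]; have [p1 p2] := ptb _ t_gt0 tt0.
  have tk : 0 < t * k by rewrite mulr_gt0.
  rewrite distrC ptd // lecR dist_bidisk; last by apply/bidiskE; split; lra.
  rewrite mulrAC ler_pdivlMr // -mulrA mulrC.
  rewrite -mulrA ler_wpM2l //; first by rewrite le_max ltW.
  by rewrite mulrC le_min; apply/andP; split; lra.
pose mx := Num.max (modulus v) (modulus u).
have mx0 : 0 < mx by rewrite lt_max mv.
exists (Num.min t0 (e / mx)); first by rewrite lt_min t00 divr_gt0.
move=> t; rewrite lt_min ltr_pdivlMr // => /and3P[t_gt0 tt0 te] s.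
have [p1 p2] := ptb _ t_gt0 tt0; have tk : 0 < t * k by rewrite mulr_gt0.
split; first by apply/bidiskE; split; rewrite -/u -/(pt t); lra.
have := Be (pt t); rewrite ptd // modulusE -rmorphM lecR /= => h.
apply: le_trans (h _) _.
  split; first by exists t; rewrite //= t_gt0.
  by rewrite ball_prod_normE /ball_ /= ptd // ltcR.
rewrite -mulrA ler_wpM2l // /s modulusM modulus_real ?(ltW t_gt0) // -/u.
rewrite mulrCA ler_wpM2l ?(ltW t_gt0) // ge_max /v modulusM.
have := modulus_ge0 (y ^+ 2); have := mulr_ge0 (modulus_ge0 u) (modulus_ge0 (y ^+ 2)).
by move=> *; apply/andP; split; nra.
Qed.

(** * The expansion of [p] and [q] in powers of the scale *)

Lemma torus_modulus tau : torus tau -> modulus tau.1 = 1 /\ modulus tau.2 = 1.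
Proof. by case=> t1 t2; split; apply: complexI; rewrite -modulusE. Qed.

(** Divide [p - omega q = (phi - omega) q] by [s ^+ k] and let [s] tend to 0 along a ray. The factor
    [0 ^+ (m.+1 - k)] is 0 for [k <= m], which serves to exclude these orders, and 1 for
    [k = m + 1], which bounds the leading term. *)
Lemma leading_coef_bound (phi : C * C -> C) tau (omega : C) (alpha : R) (y : C)
    (p q H K : {poly {poly C}}) m k :
  torus tau ->
  Bplus_bound phi tau omega alpha ->
  0 <= alpha ->
  (forall z, bidisk z -> q.[z.1, z.2] != 0 ->
    phi z = p.[z.1, z.2] / q.[z.1, z.2]) ->
  (forall s x, let z := blow_pt tau s x in q.[z.1, z.2] = H.[s, x] * s ^+ m) ->
  (forall s x, let z := blow_pt tau s x in
    p.[z.1, z.2] - omega * q.[z.1, z.2] = K.[s, x] * s ^+ k) ->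
  (k <= m.+1)%N -> 0 < complex.Re y -> H.[0, y ^+ 2] != 0 ->
  modulus K.[0, y ^+ 2] <=
    alpha * (1 + modulus (y ^+ 2)) * modulus (H.[0, y ^+ 2] * 0 ^+ (m.+1 - k)).
Proof.
move=> ttau Bp a0 phiE qE pE km y0 H0.
have [e e0 phib] := Bplus_ray ttau Bp a0 y0.
move: (y ^+ 2) H0 phib => x H0 phib.
have u0 : y^*%C != 0.
  by apply: contraTneq y0 => /(congr1 conjc); rewrite conjcK => ->; rewrite conjc0 ltxx.
have c0 : 0 <= alpha * (1 + modulus x) by rewrite mulr_ge0 // addr_ge0 // modulus_ge0.
have Hx0 : (swapXY H).[x%:P] != 0.
  by apply: contraNneq H0 => h; rewrite -horner2_swapXY h horner0.
(* [swapXY] yields polynomials in [s] at the fixed direction [x]. *)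
have := @horner_le_ray _ (swapXY K).[x%:P] ((swapXY H).[x%:P] * 'X^(m.+1 - k))
   (swapXY H).[x%:P] _ _ _ Hx0 u0 c0 e0.
rewrite !hornerM !hornerXn !horner2_swapXY; apply=> t te.
have := phib t te; rewrite !hornerM !hornerXn !horner2_swapXY /=.
set s := t%:C * _ => -[bz phiz] Hs.
have s0 : s != 0 by rewrite mulf_neq0 // gt_eqF // ltcR; case/andP: te.
have ms : 0 < modulus s by rewrite modulus_gt0.
have qz := qE s x; have pz := pE s x; move: bz phiz qz pz => /=.
set z := blow_pt tau s x => bz phiz qz pz.
have q0 : q.[z.1, z.2] != 0 by rewrite qz mulf_neq0 // expf_neq0.
have E : K.[s, x] * s ^+ k = (phi z - omega) * H.[s, x] * s ^+ m.
  by rewrite -pz phiE // -mulrA -qz mulrBl divfK.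
rewrite -(@ler_pM2r _ (modulus s ^+ k)) ?exprn_gt0 //.
rewrite -modulusX -modulusM E !modulusM !modulusX -!mulrA -exprD subnK // exprS.
have -> : alpha * ((1 + modulus x) * (modulus H.[s, x] * (modulus s * modulus s ^+ m)))
  = alpha * (1 + modulus x) * modulus s * (modulus H.[s, x] * modulus s ^+ m) by ring.
by rewrite ler_wpM2r // mulr_ge0 ?exprn_ge0 ?modulus_ge0.
Qed.

(** At points of the bidisk where [s] and [H] are nonzero, the two identities say that
    [phi - omega - s (a x + b) = s^2 G / H]. *)
Lemma blow_up_expansion (phi : C * C -> C) tau (omega : C) (alpha : R)
    (p q : {poly {poly C}}) :
  torus tau ->
  Bplus_bound phi tau omega alpha ->
  0 <= alpha -> q != 0 ->
  (forall z, bidisk z -> q.[z.1, z.2] != 0 ->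
    phi z = p.[z.1, z.2] / q.[z.1, z.2]) ->
  exists a b m (H G : {poly {poly C}}), H.[0] != 0 /\
  forall s x, let z := blow_pt tau s x in
    q.[z.1, z.2] = H.[s, x] * s ^+ m /\
    p.[z.1, z.2] - (omega + s * (a * x + b)) * q.[z.1, z.2]
      = G.[s, x] * s ^+ m.+2.
Proof.
move=> ttau Bp a0 q0 phiE.
have [t10 t20] : tau.1 != 0 /\ tau.2 != 0.
  by rewrite -!modulus_gt0; have [-> ->] := torus_modulus ttau; rewrite ltr01.
have [Q QE] := blow_up tau.1 tau.2 q.
have Q0 : Q != 0 by apply: contra_neq q0; exact: blow_up_eq0 QE.
have [m [H Hr QH]] := multiplicity_XsubC Q 0; rewrite Q0 /= rootE in Hr.
have qE s x : let z := blow_pt tau s x in q.[z.1, z.2] = H.[s, x] * s ^+ m.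
  by rewrite /= -QE QH polyC0 subr0 hornerM hornerXn hornerM -polyC_exp hornerC.
have [P PE] := blow_up tau.1 tau.2 (p - omega%:P%:P * q).
have pE s x : let z := blow_pt tau s x in
    p.[z.1, z.2] - omega * q.[z.1, z.2] = P.[s, x].
  by rewrite /= PE !(hornerD, hornerN, hornerM, hornerC).
have [A AE] : exists A : {poly {poly C}}, P = A * 'X^(m.+1).
  have [->|P0] := eqVneq P 0; first by exists 0; rewrite mul0r.
  have [k [K Kr PK]] := multiplicity_XsubC P 0.
  rewrite P0 polyC0 subr0 /= ?rootE in Kr PK.
  have [mk|km] := ltnP m k.
    by exists (K * 'X^(k - m.+1)); rewrite -mulrA -exprD subnK.
  have pK s x : let z := blow_pt tau s x in
      p.[z.1, z.2] - omega * q.[z.1, z.2] = K.[s, x] * s ^+ k.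
    by move=> z; rewrite pE PK hornerM hornerXn hornerM -polyC_exp hornerC.
  (* If the order [k] were at most [m], [K.[0]] would vanish at every [(n + 1)^2] that is not a root
     of [H.[0]], so [K.[0] * H.[0]] would have infinitely many roots. *)
  have := mulf_neq0 Kr Hr.
  case/negP; apply/eqP.
  apply: (@poly_eq0_injective_roots _ (fun n => ((n.+1%:R : R)%:C) ^+ 2)).
    move=> i j; rewrite -!(rmorphXn (real_complex R)) => /complexI/eqP.
    by rewrite eqrXn2 ?ler0n // eqr_nat => /eqP[].
  move=> n; rewrite hornerM; apply/eqP; rewrite mulf_eq0 orbC.
  have [//|Hn] := boolP (_ == 0); rewrite /=.
  have yn : 0 < complex.Re ((n.+1%:R : R)%:C) by rewrite /= ltr0n.
  have := leading_coef_bound ttau Bp a0 phiE qE pK (leqW km) yn Hn.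
  rewrite subSn // [0 ^+ _]exprS mul0r mulr0 modulus0 mulr0.
  by rewrite -modulus_eq0 eq_le modulus_ge0 => ->.
have pA s x : let z := blow_pt tau s x in
    p.[z.1, z.2] - omega * q.[z.1, z.2] = A.[s, x] * s ^+ m.+1.
  by move=> z; rewrite pE AE hornerM hornerXn hornerM -polyC_exp hornerC.
have [a [b AH]] : exists a b, A.[0] = (a *: 'X + b%:P) * H.[0].
  apply: (@affine_multiple _ _ _ H.[0] alpha) => // y y0 Hy.
  have := leading_coef_bound ttau Bp a0 phiE qE pA (leqnn _) y0 Hy.
  by rewrite subnn expr0 mulr1.
(* Subtracting the linear term kills the value at [s = 0], which yields one more factor [s]. *)
have [G GE] := poly0_factor (A - (a *: 'X + b%:P)%:P * H).
have L0 : (A - (a *: 'X + b%:P)%:P * H).[0] = 0.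
  by rewrite hornerD hornerN hornerM hornerC AH subrr.
rewrite L0 polyC0 add0r in GE.
exists a, b, m, H, G; split=> // s x z; split; first exact: qE.
have : A.[s, x] - (a * x + b) * H.[s, x] = G.[s, x] * s.
  have := congr1 (fun F => F.[s, x]) GE.
  by rewrite !(hornerD, hornerN, hornerM, hornerC, hornerX, hornerZ).
have pz : p.[z.1, z.2] - omega * q.[z.1, z.2] = A.[s, x] * s ^+ m.+1 := pA s x.
have qz : q.[z.1, z.2] = H.[s, x] * s ^+ m := qE s x.
have split_q (u v w : C) : u - (omega + w) * v = u - omega * v - w * v by ring.
rewrite split_q pz qz => GE'.
by rewrite [s ^+ m.+2]exprS [RHS]mulrA -GE' exprS; ring.
Qed.

End Bidisk.

(** * The remainder estimate at nontangential points *)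

Unset Implicit Arguments.

Theorem theorem2p9 (R : realType) (phi : R[i] * R[i] -> R[i])
    (tau : R[i] * R[i]) :
  rational_analytic phi ->
  (forall z : R[i] * R[i], bidisk z -> `|phi z| <= 1) ->
  torus tau ->
  Bplus_point phi tau ->
  C_point phi tau.
Proof.
move=> [dphi [p [q [q0 phiE]]]] _ ttau [omega [alpha [om1 [a0 Bp]]]].
have [a [b [m [H [G [H0 exp]]]]]] := blow_up_expansion ttau Bp (ltW a0) q0 phiE.
have [mt1 mt2] := torus_modulus ttau.
have [t10 t20] : tau.1 != 0 /\ tau.2 != 0 by rewrite -!modulus_gt0 mt1 mt2 ltr01.
(* Since [z - tau = (- tau_1 s x, - tau_2 s)], this [lambda] gives [s (a x + b)]. *)
exists omega, (- a / tau.1, - b / tau.2); split=> // S [Sb [M [M0 SM]]] beta beta0.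
(* Directions within [rho] of [x] stay in the bidisk. As [|x| <= M], the bound [M + 2 * rho] covers
   the circle of radius [2 * rho] around [x]. *)
pose rho := M^-1; have rho0 : 0 < rho by rewrite invr_gt0.
have [L1 L10 GL] := poly2_bounded G 1 (M + 2 * rho).
have [H1 HE] := poly0_factor H.
have [L2 L20 HL] := poly2_bounded H1 1 (M + 2 * rho).
(* For every centre [x], [|H(0, y)| >= d0] at some [y] with [|y - x| = rho]; half of this survives
   at small scales. *)
pose d0 := modulus (lead_coef H.[0]) * rho ^+ (size H.[0]).-1 / 2.
have d00 : 0 < d0.
  by rewrite divr_gt0 // mulr_gt0 ?exprn_gt0 // modulus_gt0 lead_coef_eq0.
pose d := d0 / 2; have dgt0 : 0 < d by rewrite divr_gt0.
pose cst := 2 ^+ sizeY H * L1 / d.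
have cst0 : 0 <= cst by rewrite divr_ge0 ?(ltW dgt0) // mulr_ge0 // exprn_ge0.
(* The three bounds serve, in order, for the estimates by [L1] and [L2], for [|H(s, y)| >= d], and
   for the comparison with [beta]. *)
pose eps := Num.min 1 (Num.min (d / (L2 + 1)) (beta / (cst + 1))).
have L21 : 0 < L2 + 1 by rewrite ltr_wpDl.
have cst1 : 0 < cst + 1 by rewrite ltr_wpDl.
have eps0 : 0 < eps by rewrite !lt_min ltr01 (divr_gt0 dgt0 L21) divr_gt0.
exists eps; split=> // z [Sz /ball_pairE[_ ze]].
have bz := Sb _ Sz; have /bidiskE[z1 z2] := bz.
have [s [x [sn0 e1 e2]]] : exists s x, [/\ s != 0,
    tau.1 * (s * x) = tau.1 - z.1 & tau.2 * s = tau.2 - z.2].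
  have sn0 : 1 - z.2 / tau.2 != 0.
    rewrite subr_eq0; apply: contraTneq z2 => h.
    have -> : z.2 = tau.2 by rewrite -[RHS]mul1r h divfK.
    by rewrite mt2 ltxx.
  exists (1 - z.2 / tau.2), ((1 - z.1 / tau.1) / (1 - z.2 / tau.2)); split=> //.
    by rewrite [_ * (_ / _)]mulrC divfK // mulrBr mulr1 [tau.1 * (_ / _)]mulrC divfK.
  by rewrite mulrBr mulr1 [tau.2 * (_ / _)]mulrC divfK.
have s0 : 0 < modulus s by rewrite modulus_gt0.
have ms : modulus s = modulus (tau.2 - z.2) by rewrite -e2 modulusM mt2 mul1r.
have mul1B (c w : R[i]) : c * (1 - w) = c - c * w by rewrite mulrBr mulr1.
have zE : blow_pt tau s x = z.
  by rewrite /blow_pt !mul1B e1 e2 !subKr -surjective_pairing.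
have := SM _ Sz; rewrite dist_bidisk // pair_normE lecR /= modulusB -e1 modulusB -e2.
rewrite !modulusM mt1 mt2 !mul1r.
rewrite minr_pMr ?(ltW M0) // ge_max !le_min.
move=> /andP[/andP[sx1 sx2] /andP[s1 s2]].
have s_ge : 1 - modulus z.2 <= modulus s.
  by move: (modulus_triangle tau.2 0 z.2); rewrite !subr0 mt2 ms; clear; lra.
(* Nontangentiality gives [|s x| <= M (1 - |z.2|) <= M |s|]. *)
have xM : modulus x <= M.
  by rewrite -(ler_pM2l s0) (le_trans sx2) // mulrC ler_wpM2r // ltW.
(* A change of direction moves only the first coordinate, by less than [|s| / M <= 1 - |z.1|]. *)
have disc_bidisk x' : modulus (x' - x) < rho -> bidisk (blow_pt tau s x').
  move=> xx'; apply/bidiskE; split; last first.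
    by rewrite /= mul1B e2 subKr.
  have -> : (blow_pt tau s x').1 = z.1 - tau.1 * (s * (x' - x)).
    by rewrite /= mul1B [s * (x' - x)]mulrBr [tau.1 * (_ - _)]mulrBr e1; ring.
  apply: le_lt_trans (modulusD _ _) _; rewrite modulusN !modulusM mt1 mul1r.
  rewrite -ltrBrDl; apply: (@lt_le_trans _ _ (modulus s * rho)).
    by rewrite ltr_pM2l.
  by rewrite ler_pdivrMr // mulrC.
pose f x' := phi (blow_pt tau s x') - omega - s * (a * x' + b).
have fHG x' : modulus (x' - x) < rho -> H.[s, x'] != 0 ->
    f x' * H.[s, x'] = (s ^+ 2 *: G.[s%:P]).[x'].
  move=> xx' Hx'; have [qE pE] := exp s x'.
  have qn0 : q.[(blow_pt tau s x').1, (blow_pt tau s x').2] != 0.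
    by rewrite qE mulf_neq0 // expf_neq0.
  apply: (mulIf (expf_neq0 m sn0)).
  transitivity (G.[s, x'] * s ^+ m.+2); last by rewrite hornerZ !exprS; ring.
  by rewrite -mulrA -qE -pE /f (phiE _ (disc_bidisk _ xx') qn0); field.
have fcont : polynomial_removable f x rho.
  apply: removable_of_continuous => w wx e e0.
  have /cvgrPdist_lt/(_ (e / 2)%:C) :=
    differentiable_continuous (dphi _ (disc_bidisk w wx)).
  rewrite ltcR divr_gt0 // => /(_ isT)/nbhs_pairP[d1 d10 phid].
  pose k := modulus (s * a) + 1; have k0 : 0 < k by rewrite ltr_wpDl ?modulus_ge0.
  exists (Num.min (d1 / modulus s) (e / 2 / k)).
    by rewrite lt_min (divr_gt0 d10 s0) !divr_gt0.
  move=> t /andP[t0]; rewrite lt_min !ltr_pdivlMr // => /andP[td te].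
  have mt : modulus t%:C = t by rewrite modulus_real // ltW.
  have fE : f (w + t%:C) - f w =
      phi (blow_pt tau s (w + t%:C)) - phi (blow_pt tau s w) - s * a * t%:C.
    by rewrite /f; ring.
  rewrite fE (le_trans (modulusD _ _)) // modulusN [modulus (s * a * _)]modulusM mt.
  have : modulus (phi (blow_pt tau s w) - phi (blow_pt tau s (w + t%:C))) < e / 2.
    rewrite -lt_modulus; apply: phid; apply/ball_pairE; rewrite /= subrr modulus0.
    split=> //.
    have -> : tau.1 * (1 - s * w) - tau.1 * (1 - s * (w + t%:C))
      = tau.1 * (s * t%:C) by ring.
    by rewrite !modulusM mt1 mt mul1r mulrC.
  rewrite modulusB => phil; move: te; rewrite /k mulrDr mulr1.
  by move: phil t0; rewrite [modulus _ * t]mulrC; clear; lra.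
have [y yx Hy] := exists_large_on_circle x rho0 H0.
have yM : modulus y <= M + 2 * rho.
  by move: (modulusD (y - x) x) xM rho0; rewrite subrK yx; clear; lra.
move: (ze); rewrite -ms !lt_min => /and3P[s_lt1 s_ltd s_ltb].
rewrite ltr_pdivlMr // in s_ltd; rewrite ltr_pdivlMr // in s_ltb.
(* [H(s, y)] differs from [H(0, y)] by [s H1(s, y)], of modulus at most [L2 |s| < d], and [d] is
   half of [d0]. *)
have dH : d <= modulus H.[s, y].
  have HsE : H.[0].[y] = H.[s, y] - H1.[s, y] * s.
    by rewrite [in RHS]HE hornerD hornerC hornerM hornerX hornerD hornerM hornerC addrK.
  have := modulusD H.[s, y] (- (H1.[s, y] * s)); rewrite -HsE modulusN modulusM.
  move: (HL s y (ltW s_lt1) yM) (modulus_ge0 H1.[s, y]) s0 Hy s_ltd; rewrite -/d0.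
  have d0E : d0 = d + d by rewrite /d -splitr.
  by rewrite d0E; clear; nra.
have Hs0 : H.[s%:P] != 0.
  by apply: contraTneq dH => ->; rewrite horner0 modulus0 -ltNge.
have key : modulus (f x) * d <= 2 ^+ sizeY H * (modulus s ^+ 2 * L1).
  (* [sizeY H] bounds the size of [H.[s%:P]] for all [s], so the constant is uniform in [z]. *)
  apply: (@quotient_bound _ f x y rho _ _ (s ^+ 2 *: G.[s%:P]) H.[s%:P]) => //.
  - exact: fcont Hs0 fHG.
  - move=> w wx; rewrite hornerZ modulusM modulusX ler_wpM2l ?exprn_ge0 ?modulus_ge0 //.
    apply: GL; first exact: ltW.
    by move: (modulusD (w - x) x) xM; rewrite subrK wx; clear; lra.
  - by rewrite yx.
  - exact: max_size_evalC.
have fx : f x = phi z - omega - dot (- a / tau.1, - b / tau.2) (z - tau).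
  rewrite /f zE /dot /=; congr (_ - _).
  have -> : z.1 - tau.1 = - (tau.1 * (s * x)) by rewrite e1 opprB.
  have -> : z.2 - tau.2 = - (tau.2 * s) by rewrite e2 opprB.
  by field; rewrite t10 t20.
rewrite -fx !modulusE pair_normE -rmorphM lecR.
apply: (@le_trans _ _ (beta * modulus s)); last first.
  by rewrite ler_wpM2l ?(ltW beta0) // ms le_max lexx orbT.
have {}key : modulus (f x) <= cst * modulus s ^+ 2.
  by rewrite /cst mulrAC ler_pdivlMr // -mulrA [L1 * _]mulrC.
apply: le_trans key _; rewrite expr2 mulrA ler_pM2r //.
by move: s_ltb s0; rewrite [cst * _]mulrC mulrDr mulr1; clear; lra.
Qed.
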